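(* (1) For every integer $k\ge 2$ there is a homomorphism $\mathrm{SG}(2k+2,k)\to S_4$. (2) For every positive integer $k$ there is no homomorphism $\mathrm{KG}(2k+2,k)\to S_4$.
   Context: The Kneser graph $\mathrm{KG}(n,k)$ ($n\ge 2k$) has as vertices all $k$-element subsets of $[n]=\{1,\dots,n\}$, two being adjacent iff they are disjoint. The Schrijver graph $\mathrm{SG}(n,k)$ is the induced subgraph of $\mathrm{KG}(n,k)$ on the stable $k$-subsets, i.e., those $A$ containing no pair $\{i,i+1\}$ for $i\in[n-1]$ and not containing both $1$ and $n$. The symmetric shift graph $S_m$ has vertex set $\{(i,j):1\le i,j\le m,\ i\ne j\}$, and $(i,j)$ is adjacent to $(k,\ell)$ iff $j=k$ or $i=\ell$. A homomorphism is an edge-preserving map between vertex sets. *)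

(* Defs.v *)
From mathcomp Require Import all_boot.
Set Implicit Arguments. Unset Strict Implicit. Unset Printing Implicit Defensive.

(* Ground set [n] = {1,...,n} is represented by 'I_n = {0,...,n-1}
   (element i of 'I_n stands for i+1). *)

Definition KGvert (n k : nat) : predArgType := {A : {set 'I_n} | #|A| == k}.
Definition KGadj (n k : nat) (A B : KGvert n k) : bool :=
  [disjoint (val A) & (val B)].

Definition stableb (n : nat) (A : {set 'I_n}) : bool :=
  [forall i : 'I_n, forall j : 'I_n,
     ((i \in A) && (j \in A)) ==>
     ~~ ((j == i.+1 :> nat) || ((i == 0 :> nat) && (j == n.-1 :> nat)))].

Definition SGvert (n k : nat) : predArgType :=
  {A : {set 'I_n} | (#|A| == k) && stableb A}.
Definition SGadj (n k : nat) (A B : SGvert n k) : bool :=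
  [disjoint (val A) & (val B)].

Definition Svert (m : nat) : predArgType := {p : 'I_m * 'I_m | p.1 != p.2}.
Definition Sadj (m : nat) (p q : Svert m) : bool :=
  ((val p).2 == (val q).1) || ((val p).1 == (val q).2).

Definition is_hom (V W : Type) (eV : V -> V -> bool) (eW : W -> W -> bool)
  (f : V -> W) : Prop := forall x y, eV x y -> eW (f x) (f y).

(* Main.v *)
Require Import Defs.
From mathcomp Require Import all_boot.
Set Implicit Arguments. Unset Strict Implicit. Unset Printing Implicit Defensive.

(* (1) Deleting the largest element maps SG(n+2, k+1) to SG(n, k), so it is
   enough to colour SG(6, 2).

   (2) The first coordinate of a homomorphism to S_4 is a proper 4-colouring c of
   KG(2k+2, k).  For disjoint (k-1)-sets S, T let D(S, T) be the number of
   orderings (a, b, a', b') of the remaining four points with c(S+a) = 0,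
   c(T+b) = 1, c(S+a') = 2, c(T+b') = 3.  For a homomorphism to S_4 the number
   D(S, T) is always even, a finite statement about maps from the cube graph
   formed by the S+r and T+r.  On the other hand, the sum of D(S, T) over the
   pairs with s_1 < t_1 < s_2 < t_2 < ... is odd for every proper 4-colouring.
   Grouping this sum by U = S+a+a' and pairing U with its complement V turns it
   into the sum, over U containing a fixed point z and over i in U, j in V, of
   [c(U-i) < c(V-j)] m(U-i, V-j), where m(x, y) is the number of ways of deleting
   a point from each of x and y so that the rest alternates.  Modulo 2, m(x, y)
   detects cyclic alternation.  The terms with i <> z cancel by exchanging i and
   j, and those with i = z contribute 1 for each of the 2k+1 points j <> z. *)

(** * Parity of alternating words *)

Section Alternation.
Variable I : finType.
Implicit Types (A S T : {set I}) (s : seq I).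

(* The parity of the number of ways of deleting p points of S and q points of T
   from the word s (other points are ignored) so that the rest is read by the
   automaton that goes from state false to true on S and back on T, starting in
   state b and ending in state e. *)
Fixpoint altdel S T (p q b e : bool) s : bool :=
  if s is i :: s' then
    if i \in S then
      (~~ b && altdel S T p q true e s') (+) (p && altdel S T false q b e s')
    else if i \in T then
      (b && altdel S T p q false e s') (+) (q && altdel S T p false b e s')
    else altdel S T p q b e s'
  else [&& ~~ p, ~~ q & b == e].

Lemma eq_altdel S T S' T' p q b e s :
  {in s, S =i S'} -> {in s, T =i T'} ->
  altdel S T p q b e s = altdel S' T' p q b e s.
Proof.
elim: s p q b => //= i s IHs p q b eS eT.
have {}IHs p' q' b' : altdel S T p' q' b' e s = altdel S' T' p' q' b' e s.
  by apply: IHs => j js; [apply: eS | apply: eT]; rewrite inE js orbT.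
by rewrite eS ?eT ?mem_head // !IHs.
Qed.

Lemma altdel_swap S T p q b e s : [disjoint S & T] ->
  altdel S T p q b e s = altdel T S q p (~~ b) (~~ e) s.
Proof.
move=> dST; elim: s p q b => /= [|i s IHs] p q b; first by case: p q b e => [] [] [] [].
rewrite !IHs; have [iS|iS] := boolP (i \in S); last by rewrite negbK.
by rewrite (disjointFr dST iS).
Qed.

(** A run that deletes one point of [S] is a choice of that point [i] followed by a run on [S :\ i]
    without deletion in [S]. *)
Lemma altdel_sum_l S T q b e s : uniq s -> [disjoint S & T] ->
  altdel S T true q b e s =
  \big[addb/false]_(i <- s | i \in S) altdel (S :\ i) T false q b e s.
Proof.
move=> us dST; elim: s us q b => /= [|a s IHs] => [_|/andP[nas us]] q b.
  by rewrite big_nil.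
have ne i : i \in s -> (a == i) = false.
  by move=> is_; apply/negbTE; apply: contraNneq nas => ->.
have {}IHs := IHs us; rewrite big_cons.
have [aS|aS] := boolP (a \in S).
  have aT := disjointFr dST aS; rewrite !inE eqxx /= aT IHs big_distrr addbC /=; congr addb.
    apply: eq_altdel => j js //; rewrite !inE; case: eqP => // ja.
    by rewrite -ja js in nas.
  rewrite big_seq_cond [RHS]big_seq_cond; apply: eq_bigr => i /andP[/ne ai _].
  by rewrite in_setD1 ai aS addbF.
have [aT|aT] := boolP (a \in T).
  rewrite !IHs !big_distrr -big_split; apply: eq_bigr => i _ /=.
  by rewrite in_setD1 (negbTE aS) andbF.
by rewrite IHs; apply: eq_bigr => i _; rewrite in_setD1 (negbTE aS) andbF.
Qed.

Lemma altdel_sum_r S T p b e s : uniq s -> [disjoint S & T] ->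
  altdel S T p true b e s =
  \big[addb/false]_(i <- s | i \in T) altdel S (T :\ i) p false b e s.
Proof.
move=> us dST; have dTS : [disjoint T & S] by rewrite disjoint_sym.
rewrite altdel_swap // altdel_sum_l //; apply: eq_bigr => i _.
rewrite altdel_swap ?negbK //.
by apply: disjointWl dTS; apply: subsetDl.
Qed.

Ltac case_altdel := repeat match goal with
  |- context [altdel ?S ?T ?p ?q ?b ?e ?s] => case: (altdel S T p q b e s) end.

(* The clauses are strengthened to all imbalances of at most two between S and T
   so that the induction goes through. *)
Lemma altdel_balance S T s : [disjoint S & T] ->
  let x := count [in S] s in let y := count [in T] s in
  let A p q b e := altdel S T p q b e s in
  [/\ x = y ->
        [/\ A true true false false = A false false false false (+) A false false true true,
            A true true true true = A false false false false (+) A false false true true,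
            A true false true false = A false false false false (+) A false false true true
          & A false true false true = A false false false false (+) A false false true true],
      x = y.+1 ->
        [/\ A true false false false = A false false false true,
            A true false true true = A false false false true
          & A true true false true = false],
      y = x.+1 ->
        [/\ A false true false false = A false false true false,
            A false true true true = A false false true false
          & A true true true false = false],
      x = y.+2 -> A true false false true = false
    & y = x.+2 -> A false true true false = false].
Proof.
move=> dST; elim: s => [|i s [H0 H1 H1' H2 H2']] //=.
have [iS|iS] /= := boolP (i \in S).
  rewrite (disjointFr dST iS) /= add0n add1n.
  split=> e.
  - by have [-> -> ->] := H1' (esym e); rewrite !addbF; split; case_altdel.
  - by case: e => e; have [_ -> -> ->] := H0 e; split; case_altdel.
  - by rewrite !(H2' e) addbF.
  - by case: e => e; have [_ -> _] := H1 e; case_altdel.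
  - by [].
rewrite !add0n; have [iT|iT] /= := boolP (i \in T); last by [].
rewrite add1n; split=> e.
- by have [-> -> ->] := H1 e; rewrite !addbF; split; case_altdel.
- by rewrite !(H2 e) addbF.
- by case: e => e; have [-> _ -> ->] := H0 (esym e); split; case_altdel.
- by [].
- by case: e => e; have [-> _ _] := H1' e; case_altdel.
Qed.


(** Starting from [b], the state records the running excess of letters of [S] over letters of
    [T]. *)
Lemma altdel_count S T b e s : [disjoint S & T] ->
  altdel S T false false b e s -> count [in S] s + b = count [in T] s + e.
Proof.
move=> dST; elim: s b => /= [|i s IHs] b; first by move/eqP->.
have [iS|iS] := boolP (i \in S).
  rewrite (disjointFr dST iS) addbF => /andP[nb /IHs]; case: b nb => //= _.
  by rewrite addn1 addn0 add1n add0n.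
have [iT|iT] := boolP (i \in T); last by rewrite !add0n; apply: IHs.
rewrite addbF => /andP[-> /IHs]; rewrite addn0 add0n => ->.
by rewrite addn1 add1n addSn.
Qed.

Lemma altdel_filter A S T p q b e s : S \subset A -> T \subset A ->
  altdel S T p q b e [seq i <- s | i \in A] = altdel S T p q b e s.
Proof.
move=> sSA sTA; elim: s p q b => //= i s IHs p q b.
have [iA|iA] /= := boolP (i \in A); first by rewrite !IHs.
by rewrite (contraNF (subsetP sSA i) iA) (contraNF (subsetP sTA i) iA) IHs.
Qed.

(** No letter is ignored or deleted, so the state flips each time and is [b] plus the parity of the
    position. *)
Lemma altdel_parity S T b e s : uniq s -> {in s, forall i, (i \in T) = (i \notin S)} ->
  altdel S T false false b e s =
  (b (+) e == odd (size s)) &&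
  all (fun i => (i \in S) == (b == odd (index i s))) s.
Proof.
elim: s b => [|a s IHs] b /=; first by case: b e => [] [].
move=> /andP[nas us] cST.
have {}IHs b' := IHs b' us (fun i is_ => cST i (mem_behead (s := a :: s) is_)).
rewrite cST ?mem_head // eqxx /= !IHs.
have -> b' : all (fun i => (i \in S) == (b' == odd (if a == i then 0 else (index i s).+1))) s
    = all (fun i => (i \in S) == (~~ b' == odd (index i s))) s.
  apply: eq_in_all => i is_; case: (a =P i) => [ai|_]; first by rewrite ai is_ in nas.
  by rewrite /=; case: b'; case: odd.
by case: (a \in S); case: b; case: (e); case: odd => //=; rewrite ?addbF.
Qed.

(** Starting and ending in state false encodes s_1 < t_1 < s_2 < t_2 < ... in the order of [enum I],
    ending with a point of [T]. *)
Definition alternate S T := altdel S T false false false false (enum I).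

(** This is m(S, T) modulo 2. *)
Definition interlace S T :=
  \big[addb/false]_(i in S) \big[addb/false]_(j in T) alternate (S :\ i) (T :\ j).

Lemma count_enum S : count [in S] (enum I) = #|S|.
Proof. by rewrite enumT cardE /enum_mem size_filter. Qed.

(** The double sum is the automaton with one deletion on each side; the first clause of
    [altdel_balance] reduces it to the two plain alternations, that is, to cyclic alternation. *)
Lemma interlaceE S T : [disjoint S & T] -> #|S| = #|T| ->
  interlace S T = alternate S T (+) alternate T S.
Proof.
move=> dST eST.
have [+ _ _ _ _] := altdel_balance (enum I) dST; rewrite !count_enum => /(_ eST)[+ _ _ _].
rewrite [alternate T S]altdel_swap 1?disjoint_sym //= => <-.
rewrite altdel_sum_l ?enum_uniq // big_enum_cond; apply: eq_big => // i iS.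
rewrite altdel_sum_r ?enum_uniq ?big_enum_cond //.
by apply: disjointWl dST; apply: subsetDl.
Qed.

Lemma alternate_card S T : [disjoint S & T] -> alternate S T -> #|S| = #|T|.
Proof. by move=> dST /(altdel_count dST); rewrite !count_enum !addn0. Qed.

(** Exactly one split of [A] alternates: [S] must consist of the points at even positions in [A],
    counted from 0. *)
Lemma sum_alternate A k : #|A| = k.*2 ->
  \big[addb/false]_(S : {set I} | (#|S| == k) && (S \subset A)) alternate S (A :\: S).
Proof.
move=> cA; set s := [seq i <- enum I | i \in A].
pose S0 := [set i in A | ~~ odd (index i s)].
have altE S : S \subset A -> alternate S (A :\: S) = (S == S0).
  move=> sSA; rewrite /alternate -(altdel_filter (A := A)) ?subsetDl // -/s.
  have us : uniq s by rewrite filter_uniq ?enum_uniq.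
  rewrite altdel_parity // => [|i]; last by rewrite mem_filter inE => /andP[-> _]; rewrite andbT.
  rewrite [size s]size_filter count_enum cA odd_double /=.
  apply/allP/eqP => [H|-> i].
    apply/setP=> i; rewrite !inE; have [iA|iA] := boolP (i \in A).
      have /H/eqP-> : i \in s by rewrite mem_filter iA mem_enum.
      by case: odd.
    by apply: contraNF iA; apply: (subsetP sSA).
  by rewrite mem_filter !inE => /andP[-> _] /=; case: odd.
have sS0 : S0 \subset A by apply/subsetP=> i; rewrite inE => /andP[].
have dS0 : [disjoint S0 & A :\: S0].
  by rewrite disjoints_subset; apply/subsetP=> i; rewrite !inE negb_and negbK => ->.
have cS0 : #|S0| == k.
  have /alternate_card : alternate S0 (A :\: S0) by rewrite altE.
  move/(_ dS0); rewrite cardsD (setIidPr sS0) cA => e.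
  have := subset_leq_card sS0; rewrite cA => le.
  by rewrite -(inj_eq double_inj) -addnn {2}e subnKC.
rewrite (bigD1 S0) ?cS0 //= altE // eqxx big1 // => S /andP[/andP[_ sS] /negbTE nS].
by rewrite altE.
Qed.

End Alternation.

(** * Reindexing sums modulo 2 *)

Section XorSums.
Variable I : finType.
Implicit Types (U x : {set I}).

Lemma xor_card (P : pred I) : \big[addb/false]_(i | P i) true = odd #|P|.
Proof. by rewrite big_const; elim: #|P| => //= n ->. Qed.

(** Each ordered pair is grouped with its reversal; [enum_rank] selects one of the two. *)
Lemma xor_offdiag U (G : I -> I -> bool) :
  \big[addb/false]_(i in U) \big[addb/false]_(j in U :\ i) G i j =
  \big[addb/false]_(i in U)
    \big[addb/false]_(j in U | enum_rank i < enum_rank j) (G i j (+) G j i).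
Proof.
transitivity (\big[addb/false]_(i in U)
  ((\big[addb/false]_(j in U | enum_rank i < enum_rank j) G i j) (+)
   (\big[addb/false]_(j in U | enum_rank j < enum_rank i) G i j))).
  apply: eq_bigr => i iU; rewrite (bigID (fun j => enum_rank i < enum_rank j)) /=.
  congr addb; apply: eq_bigl => j; rewrite !inE -?leqNgt -(inj_eq enum_rank_inj) -val_eqE /=;
    by case: ltngtP; rewrite ?andbT ?andbF.
rewrite big_split /=; under [RHS]eq_bigr do rewrite big_split /=.
rewrite big_split /=; congr (_ (+) _); rewrite (exchange_big_dep [in U]) /=; last by move=> i j _ /andP[].
by apply: eq_bigr => i iU; apply: eq_bigl => j; rewrite iU.
Qed.

Lemma xor_offdiag_sym U (G : I -> I -> bool) : (forall i j, G i j = G j i) ->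
  \big[addb/false]_(i in U) \big[addb/false]_(j in U :\ i) G i j = false.
Proof.
move=> symG; rewrite xor_offdiag big1 // => i _; rewrite big1 // => j _.
by rewrite symG addbb.
Qed.

(** Double counting through the bijection sending (U, i) to (U - i, i). *)
Lemma xor_setD1 (P : pred {set I}) (F : {set I} -> I -> bool) k :
  \big[addb/false]_(U : {set I} | (#|U| == k.+1) && P U) \big[addb/false]_(i in U) F (U :\ i) i =
  \big[addb/false]_(x : {set I} | #|x| == k) \big[addb/false]_(i | (i \notin x) && P (i |: x)) F x i.
Proof.
rewrite !pair_big_dep /=.
rewrite (reindex_onto (fun u : {set I} * I => (u.2 |: u.1, u.2))
                      (fun u : {set I} * I => (u.1 :\ u.2, u.2))) /=; last first.
  by case=> U i /= /andP[_ iU]; rewrite setD1K.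
apply: eq_big => [[x i]|[x i]] /=.
  rewrite xpair_eqE eqxx andbT setU11 andbT cardsU1; have [ix|ix] /= := boolP (i \in x).
    rewrite andbF; apply/negbTE; rewrite negb_and; apply/orP; right.
    by apply/eqP=> /setP/(_ i); rewrite ix !inE eqxx.
  by rewrite setU1K // eqxx andbT.
by move=> /andP[_]; rewrite xpair_eqE eqxx andbT => /eqP->.
Qed.
End XorSums.

(** * Alternating zigzags of a proper 4-colouring *)

Section Colouring.
Variables (I : finType) (k : nat) (c : {set I} -> nat).
Hypothesis cardI : #|I| = k.+1.*2.
Hypothesis c_lt4 : forall x, c x < 4.
Hypothesis c_proper : forall x y : {set I},
  #|x| = k -> #|y| = k -> [disjoint x & y] -> c x != c y.
Implicit Types (A U x y : {set I}).

(** With S = U - a - a' and T = V - b - b', where V is the complement of U, the colours are those of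
    S+a', S+a, T+b', T+b in this order. *)
Definition quad U (phi : nat -> nat -> nat -> nat -> bool) :=
  \big[addb/false]_(a in U) \big[addb/false]_(a' in U :\ a)
  \big[addb/false]_(b in ~: U) \big[addb/false]_(b' in ~: U :\ b)
    (phi (c (U :\ a)) (c (U :\ a')) (c (~: U :\ b)) (c (~: U :\ b'))
     && alternate (U :\ a :\ a') (~: U :\ b :\ b')).

Definition quad_sym (phi : nat -> nat -> nat -> nat -> bool) p p' q q' :=
  (phi p p' q q' (+) phi p p' q' q) (+) (phi p' p q q' (+) phi p' p q' q).

Lemma setD1C U i j : U :\ i :\ j = U :\ j :\ i.
Proof. by rewrite !setDDl setUC. Qed.

(** The [alternate] factor is unchanged when a, a' or b, b' are exchanged, so only the sum of [phi]
    over the four exchanges matters. *)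
Lemma quadE U phi : quad U phi =
  \big[addb/false]_(a in U) \big[addb/false]_(a' in U | enum_rank a < enum_rank a')
  \big[addb/false]_(b in ~: U) \big[addb/false]_(b' in ~: U | enum_rank b < enum_rank b')
    (quad_sym phi (c (U :\ a)) (c (U :\ a')) (c (~: U :\ b)) (c (~: U :\ b'))
     && alternate (U :\ a :\ a') (~: U :\ b :\ b')).
Proof.
rewrite /quad xor_offdiag; apply: eq_bigr => a _; apply: eq_bigr => a' _.
rewrite !xor_offdiag -big_split; apply: eq_bigr => b _ /=.
rewrite -big_split; apply: eq_bigr => b' _ /=.
by rewrite (setD1C (~: U) b' b) (setD1C U a' a) -!andb_addl.
Qed.

Lemma eq_quad U phi psi :
  {in U &, forall a a', {in ~: U &, forall b b',
    quad_sym phi (c (U :\ a)) (c (U :\ a')) (c (~: U :\ b)) (c (~: U :\ b')) =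
    quad_sym psi (c (U :\ a)) (c (U :\ a')) (c (~: U :\ b)) (c (~: U :\ b'))}} ->
  quad U phi = quad U psi.
Proof.
move=> eq_sym; rewrite !quadE; apply: eq_bigr => a aU; apply: eq_bigr => a' /andP[a'U _].
apply: eq_bigr => b bV; apply: eq_bigr => b' /andP[b'V _].
by rewrite eq_sym.
Qed.

Lemma quad2 U (g : nat -> nat -> bool) :
  quad U (fun p _ q _ => g p q) =
  \big[addb/false]_(i in U) \big[addb/false]_(j in ~: U)
    (g (c (U :\ i)) (c (~: U :\ j)) && interlace (U :\ i) (~: U :\ j)).
Proof.
apply: eq_bigr => i _; rewrite exchange_big; apply: eq_bigr => j _ /=.
rewrite big_distrr; apply: eq_bigr => i' _.
by rewrite big_distrr.
Qed.

Definition zigzag U := quad U (fun p p' q q' => [&& p == 2, p' == 0, q == 3 & q' == 1]).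
Definition below U := quad U (fun p _ q _ => p < q).

Lemma card_compl U : #|U| = k.+1 -> #|~: U| = k.+1.
Proof. by move=> cU; rewrite cardsCs setCK cU cardI -addnn addnK. Qed.

Lemma card_setD1 U i : #|U| = k.+1 -> i \in U -> #|U :\ i| = k.
Proof. by move=> cU iU; have := cardsD1 i U; rewrite iU cU => -[]. Qed.

Lemma disjoint_compl U i j : [disjoint U :\ i & ~: U :\ j].
Proof.
rewrite disjoints_subset; apply/subsetP=> a; rewrite !inE.
by case/andP=> _ ->; rewrite andbF.
Qed.

Lemma colour_neq U i j : #|U| = k.+1 -> i \in U -> j \in ~: U ->
  c (U :\ i) != c (~: U :\ j).
Proof.
move=> cU iU jV; apply: c_proper (disjoint_compl _ _ _); apply: card_setD1 => //.
exact: card_compl.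
Qed.

(** The colours of U - i and V - j differ and [interlace] is symmetric, so the two sides add up to
    [quad] of the constant [true]. This is 0, since four equal terms cancel. *)
Lemma below_compl U : #|U| = k.+1 -> below (~: U) = below U.
Proof.
move=> cU; have cV := card_compl cU.
have quad1 : quad U (fun _ _ _ _ => true) = false.
  rewrite (@eq_quad _ _ (fun _ _ _ _ => false)) //.
  by rewrite /quad; do 4 rewrite big1 // => ? _.
rewrite -[RHS]addFb -{1}quad1 /below !quad2 setCK exchange_big -big_split.
apply: eq_bigr => i iU; rewrite -big_split; apply: eq_bigr => j jV /=.
rewrite !interlaceE ?card_setD1 ?disjoint_compl // 1?disjoint_sym ?disjoint_compl //.
rewrite [alternate (~: U :\ j) _ (+) _]addbC.
by have := colour_neq cU iU jV; case: ltngtP => // _; case: (_ (+) _).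
Qed.

(* The only case in which both colour classes alternate the wrong way round: then
   the complement of U carries the whole contribution of the pair. *)
Definition odd_even U :=
  [forall i in U, odd (c (U :\ i))] && [forall j in ~: U, ~~ odd (c (~: U :\ j))].

(** Every [U :\ i] is disjoint from the sets coloured 0 and 2, so its colour is 1 or 3; dually on
    the complement. *)
Lemma odd_evenP U a a' b b' : #|U| = k.+1 ->
  a \in U -> a' \in U -> b \in ~: U -> b' \in ~: U ->
  c (U :\ a) = 1 -> c (U :\ a') = 3 -> c (~: U :\ b) = 0 -> c (~: U :\ b') = 2 ->
  odd_even U.
Proof.
move=> cU aU a'U bV b'V ca ca' cb cb'; apply/andP; split.
  apply/forall_inP=> i iU; have := colour_neq cU iU bV; have := colour_neq cU iU b'V.
  by rewrite cb cb'; have := c_lt4 (U :\ i); case: (c _) => [|[|[|[|[]]]]].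
apply/forall_inP=> j jV; have := colour_neq cU aU jV; have := colour_neq cU a'U jV.
by rewrite ca ca'; have := c_lt4 (~: U :\ j); case: (c _) => [|[|[|[|[]]]]].
Qed.

(** The symmetrised comparison is odd iff the pairs {p, p'} and {q, q'} cross, so one is {0, 2} and
    the other {1, 3}; the zigzag pattern sees only {p, p'} = {0, 2}. *)
Lemma quad_sym_check : all (fun p => all (fun p' => all (fun q => all (fun q' =>
  [&& p != q, p != q', p' != q & p' != q'] ==>
  (quad_sym (fun p p' q q' => [&& p == 2, p' == 0, q == 3 & q' == 1]) p p' q q'
     == quad_sym (fun p _ q _ => p < q) p p' q q')
  || (((p == 1) && (p' == 3) || (p == 3) && (p' == 1))
      && ((q == 0) && (q' == 2) || (q == 2) && (q' == 0))))
  (iota 0 4)) (iota 0 4)) (iota 0 4)) (iota 0 4).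
Proof. by vm_compute. Qed.

Lemma zigzag_below U : #|U| = k.+1 -> ~~ odd_even U -> zigzag U = below U.
Proof.
move=> cU nA; apply: eq_quad => a a' aU a'U b b' bV b'V.
have c4 x : c x \in iota 0 4 by rewrite mem_iota c_lt4.
move: (quad_sym_check) => /allP/(_ _ (c4 (U :\ a)))/allP/(_ _ (c4 (U :\ a'))).
move=> /allP/(_ _ (c4 (~: U :\ b)))/allP/(_ _ (c4 (~: U :\ b'))).
rewrite !colour_neq //= => /orP[/eqP//|/andP[pa pb]]; case/negP: nA.
by case/orP: pa => /andP[/eqP ? /eqP ?]; case/orP: pb => /andP[/eqP ? /eqP ?];
  [apply: (@odd_evenP _ a a' b b') | apply: (@odd_evenP _ a a' b' b)
  |apply: (@odd_evenP _ a' a b b') | apply: (@odd_evenP _ a' a b' b)].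
Qed.

Lemma zigzag_compl0 U : #|U| = k.+1 -> ~~ odd_even U -> zigzag (~: U) = false.
Proof.
move=> cU nA; rewrite /zigzag /quad setCK.
rewrite big1 // => a aV; rewrite big1 // => a' /setD1P[_ a'V].
rewrite big1 // => b bU; rewrite big1 // => b' /setD1P[_ b'U].
apply/negbTE; apply: contra nA => /andP[/and4P[/eqP ca /eqP ca' /eqP cb /eqP cb'] _].
exact: (@odd_evenP _ b' b a' a).
Qed.

(** At most one of U and its complement is [odd_even]. The other one of the pair contributes
    [below], which is the same for both, and its complement contributes 0. *)
Lemma zigzag_pair U : #|U| = k.+1 -> zigzag U (+) zigzag (~: U) = below U.
Proof.
move=> cU; have [A|nA] := boolP (odd_even U); last first.
  by rewrite zigzag_below // zigzag_compl0 // addbF.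
have cV := card_compl cU.
have nA : ~~ odd_even (~: U).
  have [i iU] : exists i, i \in U by apply/card_gt0P; rewrite cU.
  apply/negP=> /andP[_]; rewrite setCK => /forall_inP/(_ i iU).
  by case/andP: A => /forall_inP/(_ i iU) ->.
by rewrite (zigzag_below cV nA) -{1}[U]setCK zigzag_compl0 // below_compl.
Qed.


Lemma sum_zigzag_below z :
  \big[addb/false]_(U : {set I} | #|U| == k.+1) zigzag U =
  \big[addb/false]_(U : {set I} | (#|U| == k.+1) && (z \in U)) below U.
Proof.
rewrite (bigID (fun U : {set I} => z \in U)) /=.
rewrite [X in _ (+) X](reindex_inj (inv_inj (@setCK I))) /=.
rewrite [X in _ (+) X](eq_bigl (fun U : {set I} => (#|U| == k.+1) && (z \in U))).
  by rewrite -big_split; apply: eq_bigr => U /andP[/eqP cU _]; rewrite -zigzag_pair.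
move=> U; rewrite inE negbK; congr andb; apply/eqP/eqP => /card_compl //.
by rewrite setCK.
Qed.

(** Split [interlace] into two alternations and replace x by its complement in the second. As the
    two colours differ, the inequalities add up to 1, leaving [sum_alternate]. *)
Lemma sum_lt_interlace A : #|A| = k.*2 ->
  \big[addb/false]_(x : {set I} | (#|x| == k) && (x \subset A))
    ((c x < c (A :\: x)) && interlace x (A :\: x)).
Proof.
move=> cA; rewrite /is_true -[RHS](sum_alternate cA).
have cC x : x \subset A -> (#|A :\: x| == k) = (#|x| == k).
  move=> sxA; rewrite cardsD (setIidPr sxA) cA.
  have := subset_leq_card sxA; rewrite cA -addnn => le.
  by apply/eqP/eqP => [e|->]; [apply: (@addnI k); rewrite -{1}e subnK | rewrite addnK].
have dC x : [disjoint x & A :\: x].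
  by rewrite disjoints_subset; apply/subsetP=> i; rewrite !inE negb_and negbK => ->.
transitivity (\big[addb/false]_(x : {set I} | (#|x| == k) && (x \subset A))
    ((c x < c (A :\: x)) && alternate x (A :\: x) (+)
     (c x < c (A :\: x)) && alternate (A :\: x) x)).
  apply: eq_bigr => x /andP[cx sxA].
  by rewrite interlaceE ?dC ?andb_addr // (eqP cx); apply/esym/eqP; rewrite cC.
rewrite big_split /= [X in _ (+) X](reindex_onto (fun x => A :\: x) (fun x => A :\: x)) /=; last first.
  by move=> x /andP[_ sxA]; rewrite setDDr setDv set0U; apply/setIidPr.
rewrite [X in _ (+) X](eq_bigl (fun x : {set I} => (#|x| == k) && (x \subset A))) => [|x].
  rewrite -big_split; apply: eq_bigr => x /andP[/eqP cx sxA] /=.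
  rewrite setDDr setDv set0U (setIidPr sxA) -andb_addl.
  have /c_proper : #|x| = k by []. move/(_ (A :\: x)).
  have -> : #|A :\: x| = k by apply/eqP; rewrite cC // cx.
  by move=> /(_ erefl (dC x)); case: ltngtP.
rewrite setDDr setDv set0U subsetDl andbT.
have [sxA|nsxA] := boolP (x \subset A); first by rewrite cC // (setIidPr sxA) eqxx.
rewrite andbF; apply/negbTE; rewrite negb_and orbC; apply/orP; left.
by apply: contra nsxA => /eqP<-; apply: subsetIl.
Qed.

Lemma sum_below z :
  \big[addb/false]_(U : {set I} | (#|U| == k.+1) && (z \in U)) below U.
Proof.
pose H x i := \big[addb/false]_(j in ~: (i |: x))
  ((c x < c (~: (i |: x) :\ j)) && interlace x (~: (i |: x) :\ j)).
transitivity (\big[addb/false]_(U : {set I} | (#|U| == k.+1) && (z \in U))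
    \big[addb/false]_(i in U) H (U :\ i) i).
  apply: eq_bigr => U _; rewrite /below quad2; apply: eq_bigr => i iU.
  by rewrite /H setD1K.
(* Here x = U - i, and z lies in U: either z is in x, or i = z. *)
rewrite xor_setD1 (bigID (fun x : {set I} => z \in x)) /= big1 => [|x /andP[_ zx]].
  rewrite addFb.
  transitivity (\big[addb/false]_(x : {set I} | (#|x| == k) && (z \notin x))
    \big[addb/false]_(j in ~: (z |: x))
       ((c x < c (~: [set z; j] :\: x)) && interlace x (~: [set z; j] :\: x))).
    apply: eq_bigr => x /andP[_ zx].
    rewrite (big_pred1 z) => [|i]; last first.
      by rewrite !inE (negbTE zx) orbF [z == i]eq_sym; case: eqP => [->|_]; rewrite ?zx ?andbF.
    apply: eq_bigr => j _.
    have -> // : ~: (z |: x) :\ j = ~: [set z; j] :\: x.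
    by apply/setP=> i; rewrite !inE !negb_or; case: (i == j); case: (i == z); case: (i \in x).
  rewrite (exchange_big_dep (fun j => j != z)) /=; last first.
    by move=> x j _; rewrite !inE negb_or => /andP[].
  (* For fixed j, the set x ranges over the halves of the 2k points other than z and j, which gives
     1. *)
  transitivity (\big[addb/false]_(j | j != z) true); last first.
    by rewrite xor_card cardC1 cardI doubleS /= odd_double.
  apply: eq_bigr => j jz.
  rewrite (eq_bigl (fun x : {set I} => (#|x| == k) && (x \subset ~: [set z; j]))) => [|x].
    apply: sum_lt_interlace; rewrite cardsCs setCK cards2 eq_sym jz cardI.
    by rewrite doubleS subn2.
  rewrite -andbA; congr andb; rewrite !inE negb_or jz /=.
  by rewrite subsetC subUset !sub1set !inE.
(* Terms with z in x: i and j are two points removed from the complement of x, and the summand is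
   symmetric in them. *)
rewrite (eq_bigl [in ~: x]) => [|i]; last by rewrite !inE zx orbT andbT.
transitivity (\big[addb/false]_(i in ~: x) \big[addb/false]_(j in ~: x :\ i)
   ((c x < c (~: x :\ i :\ j)) && interlace x (~: x :\ i :\ j))).
  have e i : ~: (i |: x) = ~: x :\ i by rewrite setCU setIC setDE.
  by apply: eq_bigr => i _; rewrite /H e.
by apply: xor_offdiag_sym => i j; rewrite setD1C.
Qed.

Lemma sum_zigzag : \big[addb/false]_(U : {set I} | #|U| == k.+1) zigzag U.
Proof.
have [z _] : exists z : I, z \in I by apply/card_gt0P; rewrite cardI.
by rewrite (sum_zigzag_below z) sum_below.
Qed.

End Colouring.

(** * Zigzags of a homomorphism to the shift graph *)

Definition shift_adj (p q : nat * nat) := (p.2 == q.1) || (p.1 == q.2).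

Definition shift4 : seq (nat * nat) :=
  [seq (i, j) | i <- iota 0 4, j <- [seq j <- iota 0 4 | i != j]].

Definition xor_seq T (F : T -> bool) := foldr (fun x b => F x (+) b) false.

(** D(S, T) modulo 2, with the remaining points numbered 0 to 3: [xs] and [ys] list the images of
    S+r and T+r, and i, j, u, v are the numbers of a', a, b, b'. *)
Definition zigzag4 (xs ys : seq (nat * nat)) :=
  xor_seq (fun i => xor_seq (fun j => xor_seq (fun u => xor_seq (fun v =>
    uniq [:: i; j; u; v] &&
    [&& (nth (0, 0) xs i).1 == 2, (nth (0, 0) xs j).1 == 0,
        (nth (0, 0) ys v).1 == 3 & (nth (0, 0) ys u).1 == 1])
    (iota 0 4)) (iota 0 4)) (iota 0 4)) (iota 0 4).

(* The filters prune the 12^8 assignments to about a thousand. *)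
Lemma zigzag4_check :
  all (fun x0 => all (fun x1 => all (fun y2 => all (fun y3 =>
  all (fun x2 => all (fun x3 => all (fun y0 => all (fun y1 =>
    ~~ zigzag4 [:: x0; x1; x2; x3] [:: y0; y1; y2; y3])
  [seq y1 <- shift4 | [&& shift_adj x0 y1, shift_adj x2 y1 & shift_adj x3 y1]])
  [seq y0 <- shift4 | [&& shift_adj x1 y0, shift_adj x2 y0 & shift_adj x3 y0]])
  [seq x3 <- shift4 | shift_adj x3 y2])
  [seq x2 <- shift4 | shift_adj x2 y3])
  [seq y3 <- shift4 | [&& y3.1 == 3, shift_adj x0 y3 & shift_adj x1 y3]])
  [seq y2 <- shift4 | [&& y2.1 == 1, shift_adj x0 y2 & shift_adj x1 y2]])
  [seq x1 <- shift4 | x1.1 == 0])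
  [seq x0 <- shift4 | x0.1 == 2].
Proof. by vm_compute. Qed.

(** The four colour hypotheses say that the numbering itself is a contributing ordering; without any
    such ordering the sum vanishes anyway. *)
Lemma zigzag4_even (f g : nat -> nat * nat) :
  (forall i, f i \in shift4) -> (forall i, g i \in shift4) ->
  (forall i j, i < 4 -> j < 4 -> i != j -> shift_adj (f i) (g j)) ->
  (f 0).1 = 2 -> (f 1).1 = 0 -> (g 2).1 = 1 -> (g 3).1 = 3 ->
  zigzag4 [:: f 0; f 1; f 2; f 3] [:: g 0; g 1; g 2; g 3] = false.
Proof.
move=> f4 g4 fg f0 f1 g2 g3; apply/negbTE.
move: zigzag4_check.
move=> /allP/(_ (f 0)); rewrite mem_filter f4 f0 => /(_ isT).
move=> /allP/(_ (f 1)); rewrite mem_filter f4 f1 => /(_ isT).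
move=> /allP/(_ (g 2)); rewrite mem_filter g4 g2 !fg // => /(_ isT).
move=> /allP/(_ (g 3)); rewrite mem_filter g4 g3 !fg // => /(_ isT).
move=> /allP/(_ (f 2)); rewrite mem_filter f4 !fg // => /(_ isT).
move=> /allP/(_ (f 3)); rewrite mem_filter f4 !fg // => /(_ isT).
move=> /allP/(_ (g 0)); rewrite mem_filter g4 !fg // => /(_ isT).
by move=> /allP/(_ (g 1)); rewrite mem_filter g4 !fg // => /(_ isT).
Qed.

Section XorSupport.
Variable I : finType.

Lemma xor_exists (P F : pred I) : \big[addb/false]_(i | P i) F i -> exists2 i, P i & F i.
Proof.
move=> s; apply/exists_inP; apply: contraLR s => /exists_inPn noF.
by rewrite big1 // => i /noF/negbTE.
Qed.

Lemma xor_nth (x0 : I) (s : seq I) (F : pred I) : uniq s -> (forall i, F i -> i \in s) ->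
  \big[addb/false]_i F i = xor_seq (fun m => F (nth x0 s m)) (iota 0 (size s)).
Proof.
move=> us Fs; transitivity (\big[addb/false]_(i <- s) F i).
  rewrite (bigID [in s]) /= [X in _ (+) X]big1 ?addbF ?big_uniq // => i is_.
  by apply/negbTE; apply: contra is_; apply: Fs.
rewrite (big_nth x0) /index_iota subn0.
by elim: iota => [|m r IHr]; rewrite ?big_nil // big_cons IHr.
Qed.

Lemma eq_in_xor_seq (T : eqType) (s : seq T) (F G : T -> bool) :
  {in s, F =1 G} -> xor_seq F s = xor_seq G s.
Proof.
elim: s => //= x s IHs eFG; rewrite eFG ?mem_head // IHs // => y ys.
by rewrite eFG // inE ys orbT.
Qed.

End XorSupport.

Section ShiftHom.
Variables (I : finType) (l : nat) (f : {set I} -> nat * nat).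
Hypothesis cardI : #|I| = l.+2.*2.
Hypothesis f4 : forall x, f x \in shift4.
Hypothesis f_hom : forall x y : {set I},
  #|x| = l.+1 -> #|y| = l.+1 -> [disjoint x & y] -> shift_adj (f x) (f y).
Implicit Types (S T U x : {set I}).

Let c x := (f x).1.

Let zz S T a' a b b' :=
  [&& c (a' |: S) == 2, c (a |: S) == 0, c (b' |: T) == 3 & c (b |: T) == 1]
  && alternate S T.

Lemma sum_zigzag_expand : \big[addb/false]_(U : {set I} | #|U| == l.+2) zigzag c U =
  \big[addb/false]_(S : {set I} | #|S| == l) \big[addb/false]_T
  \big[addb/false]_a' \big[addb/false]_a \big[addb/false]_b \big[addb/false]_b'
  ([&& uniq [:: a'; a; b; b'], all [in ~: S] [:: a'; a; b; b'] &
      T == ~: S :\: [set z in [:: a'; a; b; b']]] && zz S T a' a b b').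
Proof.
(* The two points of U - S are removed one at a time: first x = U - a, then S = x - a' in [F']. *)
pose F x a := \big[addb/false]_(a' in x)
  \big[addb/false]_(b in ~: (a |: x)) \big[addb/false]_(b' in ~: (a |: x) :\ b)
   ([&& c x == 2, c ((a |: x) :\ a') == 0, c (~: (a |: x) :\ b) == 3 & c (~: (a |: x) :\ b') == 1]
    && alternate (x :\ a') (~: (a |: x) :\ b :\ b')).
transitivity (\big[addb/false]_(U : {set I} | (#|U| == l.+2) && true)
    \big[addb/false]_(a in U) F (U :\ a) a).
  apply: eq_big => [U|U _]; first by rewrite andbT.
  by apply: eq_bigr => a aU; rewrite /F setD1K.
rewrite (xor_setD1 predT).
pose F' S a' := \big[addb/false]_(a in ~: (a' |: S))
  \big[addb/false]_(b in ~: (a |: (a' |: S))) \big[addb/false]_(b' in ~: (a |: (a' |: S)) :\ b)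
   ([&& c (a' |: S) == 2, c ((a |: (a' |: S)) :\ a') == 0,
     c (~: (a |: (a' |: S)) :\ b) == 3 & c (~: (a |: (a' |: S)) :\ b') == 1]
    && alternate S (~: (a |: (a' |: S)) :\ b :\ b')).
transitivity (\big[addb/false]_(x : {set I} | (#|x| == l.+1) && true)
    \big[addb/false]_(a' in x) F' (x :\ a') a').
  apply: eq_big => [x|x _]; first by rewrite andbT.
  rewrite /F exchange_big; apply: eq_bigr => a' a'x /=; rewrite /F' setD1K //.
  by apply: eq_bigl => a; rewrite !inE andbT.
rewrite (xor_setD1 predT); apply: eq_bigr => S cS.
transitivity (\big[addb/false]_a' \big[addb/false]_a \big[addb/false]_b \big[addb/false]_b'
  ([&& uniq [:: a'; a; b; b'] & all [in ~: S] [:: a'; a; b; b']]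
   && zz S (~: S :\: [set z in [:: a'; a; b; b']]) a' a b b')).
  rewrite big_mkcond; apply: eq_bigr => a' _; rewrite andbT.
  have [a'S|a'S] /= := boolP (a' \in S).
    by symmetry; rewrite big1 // => a _; rewrite big1 // => b _; rewrite big1 // => b' _;
      rewrite !inE a'S andbF.
  rewrite /F' big_mkcond; apply: eq_bigr => a _; rewrite !inE.
  case: ifP => [|naS]; last first.
    symmetry; rewrite big1 // => b _; rewrite big1 // => b' _; rewrite !inE.
    by move: naS; rewrite [a' == a]eq_sym; case: (a == a') => //=; case: (a \in S); rewrite ?orbT /= ?andbF.
  rewrite negb_or => /andP[naa' aS].
  rewrite big_mkcond; apply: eq_bigr => b _; rewrite !inE.
  case: ifP => [|nbS]; last first.
    symmetry; rewrite big1 // => b' _; rewrite !inE; move: nbS.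
    rewrite [a' == b]eq_sym [a == b]eq_sym.
    by case: (b == a) => //=; case: (b == a') => //=;
      rewrite ?orbT /= ?andbF //; case: (b \in S); rewrite ?orbT /= ?andbF.
  rewrite !negb_or => /and3P[nba nba' bS].
  rewrite big_mkcond; apply: eq_bigr => b' _; rewrite !inE.
  case: ifP => [|nbS]; last first.
    symmetry; move: nbS.
    rewrite [a' == b']eq_sym [a == b']eq_sym [b == b']eq_sym.
    by case: (b' == b) => //=; case: (b' == a) => //=; case: (b' == a') => //=;
      rewrite ?orbT /= ?andbF //; case: (b' \in S); rewrite ?orbT /= ?andbF.
  rewrite !negb_or => /and4P[nb'b nb'a nb'a' b'S].
  rewrite [a' == b']eq_sym [a == b']eq_sym [b == b']eq_sym [a' == b]eq_sym [a == b]eq_sym.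
  rewrite [a' == a]eq_sym.
  rewrite (negbTE naa') (negbTE nba) (negbTE nba') (negbTE nb'a) (negbTE nb'b).
  rewrite (negbTE nb'a') a'S aS bS b'S /= /zz.
  have -> : (a |: (a' |: S)) :\ a' = a |: S.
    apply/setP=> i; rewrite !inE; case: (eqVneq i a') => [->|//] /=.
    by rewrite eq_sym (negbTE naa') (negbTE a'S).
  have eT : ~: (a |: (a' |: S)) :\ b :\ b' = ~: S :\: [set z in [:: a'; a; b; b']].
    by apply/setP=> i; rewrite !inE !negb_or; case: (i == a); case: (i == a'); case: (i == b); case: (i == b').
  rewrite -eT setD1K ?inE ?negb_or ?nb'b ?nb'a ?nb'a' //.
  by rewrite (setD1C _ b b') setD1K // !inE !negb_or eq_sym nb'b nba nba'.
(* The sum over T moves innermost, where only the value determined by S and the four points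
   survives. *)
symmetry; rewrite exchange_big; apply: eq_bigr => a' _ /=.
rewrite exchange_big; apply: eq_bigr => a _ /=.
rewrite exchange_big; apply: eq_bigr => b _ /=.
rewrite exchange_big; apply: eq_bigr => b' _ /=.
set T0 := _ :\: _; rewrite (bigD1 T0) //= eqxx big1 => [|T /negbTE nT]; last by rewrite nT !andbF.
by rewrite addbF !andbT.
Qed.

(** An odd sum has a contributing ordering, which serves as numbering of the four remaining points
    and turns the sum into [zigzag4]. *)
Lemma zigzag_pair_even S T : #|S| = l ->
  \big[addb/false]_a' \big[addb/false]_a \big[addb/false]_b \big[addb/false]_b'
  ([&& uniq [:: a'; a; b; b'], all [in ~: S] [:: a'; a; b; b'] &
      T == ~: S :\: [set z in [:: a'; a; b; b']]] && zz S T a' a b b') = false.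
Proof.
move=> cS; apply/negP=> nz; have := nz.
case/xor_exists=> r0 _ /xor_exists[r1 _] /xor_exists[r2 _] /xor_exists[r3 _].
set rs := [:: r0; r1; r2; r3]; case/andP=> /and3P[us sS /eqP eT].
case/andP=> /and4P[/eqP c0 /eqP c1 /eqP c3 /eqP c2] alt.
have condE t : size t = 4 -> [&& uniq t, all [in ~: S] t & T == ~: S :\: [set z in t]] =
    uniq t && all [in rs] t.
  move=> st; case ut : (uniq t) => //=; apply/andP/allP => [[tS /eqP eT'] i it|trs].
    have := allP tS i it; rewrite /= inE => iS.
    have : i \notin T by rewrite eT' !inE it.
    by rewrite eT inE inE [_ \in ~: S]inE iS andbT negbK.
  have [|_ ers] := uniq_min_size ut trs; first by rewrite st.
  split; first by apply/allP=> i; rewrite ers; apply: (allP sS).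
  by apply/eqP; rewrite eT; apply/setP=> i; rewrite !in_setD [i \in finset _]in_set [X in _ = ~~ X && _]in_set ers.
have cT : #|T| = l.
  rewrite eT cardsD (setIidPr _).
    rewrite cardsCs setCK cS cardI cardsE.
    have -> : #|rs| = 4 by apply/card_uniqP: us.
    by rewrite -subnDA addn4 !doubleS !subSS -addnn addnK.
  by apply/subsetP=> i; rewrite inE; apply: (allP sS).
have rsS i : i \in rs -> i \notin S by move/(allP sS); rewrite inE.
have rsT i : i \in rs -> i \notin T by rewrite eT !inE => ->.
have dST : [disjoint S & T].
  by rewrite eT disjoints_subset; apply/subsetP=> i iS; rewrite !inE iS !andbF.
have nth_rs m : nth r0 rs m \in rs.
  have [lt|ge] := ltnP m 4; first exact: mem_nth.
  by rewrite nth_default // mem_head.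
pose g m := f (nth r0 rs m |: S); pose h m := f (nth r0 rs m |: T).
have adj i j : i < 4 -> j < 4 -> i != j -> shift_adj (g i) (h j).
  move=> i4 j4 nij; apply: f_hom; rewrite ?cardsU1 ?rsS ?rsT ?cS ?cT //.
  rewrite -setI_eq0; apply/eqP/setP=> z; rewrite !inE.
  have [->|_] := eqVneq z (nth r0 rs i); first by rewrite nth_uniq // (negbTE nij) (negbTE (rsT _ _)).
  have [->|_] := eqVneq z (nth r0 rs j); first by rewrite (negbTE (rsS _ _)).
  by have [/(disjointFr dST)|] := boolP (z \in S).
have rs_of t : size t = 4 ->
    [&& uniq t, all [in ~: S] t & T == ~: S :\: [set z in t]] -> {subset t <= rs}.
  by move=> st; rewrite condE // => /andP[_ /allP].
move: nz; rewrite (_ : (\big[_/_]_a' _) = zigzag4 [:: g 0; g 1; g 2; g 3] [:: h 0; h 1; h 2; h 3]).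
  by rewrite zigzag4_even // => i; apply: f4.
rewrite /zigzag4 (xor_nth r0 us) => [|a' /xor_exists[a _] /xor_exists[b _] /xor_exists[b' _] /andP[/rs_of]]; last first.
  by move=> /(_ erefl) sub _; apply: sub; rewrite !inE eqxx ?orbT.
apply: eq_in_xor_seq => i; rewrite mem_iota add0n => /andP[_ i4].
rewrite (xor_nth r0 us) => [|a /xor_exists[b _] /xor_exists[b' _] /andP[/rs_of]]; last first.
  by move=> /(_ erefl) sub _; apply: sub; rewrite !inE eqxx ?orbT.
apply: eq_in_xor_seq => j; rewrite mem_iota add0n => /andP[_ j4].
rewrite (xor_nth r0 us) => [|b /xor_exists[b' _] /andP[/rs_of]]; last first.
  by move=> /(_ erefl) sub _; apply: sub; rewrite !inE eqxx ?orbT.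
apply: eq_in_xor_seq => u; rewrite mem_iota add0n => /andP[_ u4].
rewrite (xor_nth r0 us) => [|b' /andP[/rs_of]]; last first.
  by move=> /(_ erefl) sub _; apply: sub; rewrite !inE eqxx ?orbT.
apply: eq_in_xor_seq => v; rewrite mem_iota add0n => /andP[_ v4].
rewrite condE // (_ : [:: nth r0 rs i; nth r0 rs j; nth r0 rs u; nth r0 rs v] =
  map (nth r0 rs) [:: i; j; u; v]) //.
have inj : {in [:: i; j; u; v] &, injective (nth r0 rs)}.
  have lt4 w : w \in [:: i; j; u; v] -> w < size rs by rewrite !inE => /or4P[]/eqP->.
  by move=> w w' /lt4 lw /lt4 lw' /eqP; rewrite nth_uniq // => /eqP.
rewrite (map_inj_in_uniq inj).
have -> : all [in rs] [seq nth r0 rs w | w <- [:: i; j; u; v]].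
  by apply/allP=> z /mapP[w _ ->].
have nth4 (e : nat -> nat * nat) w : w < 4 -> nth (0, 0) [:: e 0; e 1; e 2; e 3] w = e w.
  by case: w => [|[|[|[|[]]]]].
by rewrite andbT /zz alt andbT !nth4.
Qed.

Lemma no_shift_hom : False.
Proof.
have := @sum_zigzag I l.+1 c cardI; rewrite sum_zigzag_expand big1 => [|S /eqP cS].
  move=> nz; suff: false by []; apply: nz.
  - by move=> x; have := f4 x; rewrite /c; move: (f x); apply/allP.
  move=> x y cx cy dxy; rewrite /c; have := f_hom cx cy dxy; have := f4 x; have := f4 y.
  (* First coordinates colour the shift graph properly, since the two entries of a vertex differ. *)
  have chk : all (fun p => all (fun q => shift_adj p q ==> (p.1 != q.1)) shift4) shift4 by [].
  by move=> yin xin; apply/implyP; move/allP: chk => /(_ _ xin)/allP/(_ _ yin).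
by rewrite big1 // => T _; apply: zigzag_pair_even.
Qed.

End ShiftHom.

Lemma mem_shift4 p : (p \in shift4) = [&& p.1 < 4, p.2 < 4 & p.1 != p.2].
Proof. by case: p => [[|[|[|[|i]]]] [|[|[|[|j]]]]]. Qed.

Lemma KG_no_hom l (f : KGvert (2 * l.+1 + 2) l.+1 -> Svert 4) :
  ~ is_hom (@KGadj (2 * l.+1 + 2) l.+1) (@Sadj 4) f.
Proof.
move=> hf; pose pos (v : Svert 4) : nat * nat := (val (val v).1, val (val v).2).
(* Sets of the wrong size get the default (0, 1), which lies in [shift4]. *)
pose g (x : {set 'I_(2 * l.+1 + 2)}) := oapp (fun v => pos (f v)) (0, 1) (insub x).
apply: (@no_shift_hom _ l g); first by rewrite card_ord mul2n addn2 -doubleS.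
  move=> x; rewrite /g; case: insubP => [u _ _|_] //=; rewrite mem_shift4 /= !ltn_ord /=.
  exact: (valP (f u)).
move=> x y /eqP cx /eqP cy dxy; rewrite /g !insubT /=.
by have := hf (Sub x cx) (Sub y cy); rewrite /KGadj /Sadj !SubK -!val_eqE; apply.
Qed.

Definition Svert_of (p : nat * nat) : Svert 4 :=
  insubd (Sub (ord0, lift ord0 ord0) isT : Svert 4) (inord p.1, inord p.2).

Lemma Svert_of_adj p q : p \in shift4 -> q \in shift4 ->
  Sadj (Svert_of p) (Svert_of q) = shift_adj p q.
Proof.
have val_of r : r \in shift4 -> val (Svert_of r) = (inord r.1, inord r.2).
  rewrite mem_shift4 => /and3P[r1 r2 ne]; rewrite /Svert_of val_insubd.
  by rewrite /= -val_eqE /= !inordK // ne.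
move=> ip iq; rewrite /Sadj !val_of // /shift_adj /= -!val_eqE /=.
move: ip iq; rewrite !mem_shift4 => /and3P[? ? _] /and3P[? ? _].
by rewrite !inordK.
Qed.

(** * Schrijver graphs *)

(** The nine vertices of SG(6, 2) as bit vectors, each with its image in S_4, so that the
    homomorphism is checked by computation. *)
Definition stable6 : seq (bitseq * (nat * nat)) :=
  let m i j := mkseq (fun u => (u == i) || (u == j)) 6 in
  [:: (m 0 2, (0, 1)); (m 0 3, (0, 2)); (m 0 4, (3, 1)); (m 1 3, (1, 2));
      (m 1 4, (3, 0)); (m 1 5, (1, 0)); (m 2 4, (2, 1)); (m 2 5, (2, 3));
      (m 3 5, (1, 3))].

Definition stable6_colour s := nth (0, 1) (unzip2 stable6) (index s (unzip1 stable6)).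

Lemma stable6_check : all (fun s => (stable6_colour s \in shift4) &&
  all (fun t => has (fun i => nth false s i && nth false t i) (iota 0 6)
             || shift_adj (stable6_colour s) (stable6_colour t)) (unzip1 stable6))
  (unzip1 stable6).
Proof. by vm_compute. Qed.

Definition bits6 (A : {set 'I_6}) := mkseq (fun i => inord i \in A) 6.

Lemma stable6P (A : {set 'I_6}) : #|A| == 2 -> stableb A -> bits6 A \in unzip1 stable6.
Proof.
move=> cA /forallP stA; pose b i := inord i \in A.
have st i j : i < 6 -> j < 6 -> (j == i.+1) || (i == 0) && (j == 5) -> ~~ (b i && b j).
  move=> i6 j6 ij; have /forallP/(_ (inord j)) := stA (inord i).
  by rewrite /= !inordK // ij implybF.
have cb : count b (iota 0 6) = 2.
  rewrite -[RHS](eqP cA) -count_enum -val_enum_ord count_map.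
  by apply: eq_count => i; rewrite /= /b inord_val.
(* The size and the six edges of the 6-cycle decide all 64 bit vectors. *)
move: cb (st 0 1 isT isT isT) (st 1 2 isT isT isT) (st 2 3 isT isT isT).
move: (st 3 4 isT isT isT) (st 4 5 isT isT isT) (st 0 5 isT isT isT).
rewrite -[bits6 A]/[:: b 0; b 1; b 2; b 3; b 4; b 5] /=.
by case: (b 0); case: (b 1); case: (b 2); case: (b 3); case: (b 4); case: (b 5).
Qed.

Definition has_hom_S4 n k := exists f : SGvert n k -> Svert 4, is_hom (@SGadj n k) (@Sadj 4) f.

Lemma SG62_hom : has_hom_S4 6 2.
Proof.
exists (fun v => Svert_of (stable6_colour (bits6 (val v)))) => u v duv.
have /andP[cu su] := valP u; have /andP[cv sv] := valP v.
have /allP chk := stable6_check.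
have /andP[u4 /allP chku] := chk _ (stable6P cu su).
have /andP[v4 _] := chk _ (stable6P cv sv).
rewrite Svert_of_adj //; have /orP[/hasP[i]|//] := chku _ (stable6P cv sv).
rewrite mem_iota => /andP[_ i6]; rewrite !nth_mkseq // => /andP[iu].
by rewrite (disjointFr duv iu).
Qed.

(** * Deleting the largest element of a stable set *)

Section Shrink.
Variable n : nat.
Implicit Types A B : {set 'I_n.+2}.

Let widen2 := @widen_ord n n.+2 (leq_addl 2 n).

Definition drop_max A : {set 'I_n} := [set i | (widen2 i \in A) && [exists j in A, i < j]].

Lemma stableP (m : nat) (A : {set 'I_m}) i j : stableb A -> i \in A -> j \in A ->
  ~~ ((j == i.+1 :> nat) || (i == 0 :> nat) && (j == m.-1 :> nat)).
Proof. by move=> /forallP/(_ i)/forallP/(_ j)/implyP st iA jA; apply: st; rewrite iA. Qed.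

(** By stability every other element is at least 2 below the maximum, hence below n: restricting to
    ['I_n] loses only the maximum. *)
Lemma card_drop_max A k : stableb A -> #|A| == k.+1 -> #|drop_max A| == k.
Proof.
move=> st /eqP cA; have [i0 i0A] : exists i, i \in A by apply/card_gt0P; rewrite cA.
case: (@arg_maxnP _ i0 [in A] (fun i => i) i0A) => m mA max_m.
have -> : #|drop_max A| = #|A :\ m|.
  have inj : injective widen2 by move=> i j [] /val_inj.
  rewrite -(card_imset _ inj); apply: eq_card => j.
  rewrite !inE; apply/imsetP/andP => [[i]|[jm jA]].
    rewrite inE => /andP[iA /exists_inP[j' j'A lt]] ->; split=> //.
    apply: contraTneq lt => ei; have := max_m j' j'A; rewrite -leqNgt -ei.
    by [].
  have ltjm : j < m by rewrite ltn_neqAle val_eqE jm; apply: max_m.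
  have jn : j < n.
    have := stableP st jA mA; rewrite negb_or => /andP[nm _].
    have lt2 : j.+1 < m by rewrite ltn_neqAle eq_sym nm.
    by have := leq_trans lt2 (ltn_ord m); rewrite !ltnS.
  exists (Ordinal jn); last exact: val_inj.
  rewrite inE; apply/andP; split; last by apply/exists_inP; exists m.
  by rewrite (_ : widen2 _ = j) //; apply: val_inj.
by have := cardsD1 m A; rewrite mA cA => -[->].
Qed.

(** Only the wrap-around pair 0, n-1 is new. A larger element of [A] would be n, next to n-1, or
    n+1, cyclically next to 0. *)
Lemma stable_drop_max A : stableb A -> stableb (drop_max A).
Proof.
move=> st; apply/forallP=> i; apply/forallP=> j; apply/implyP; rewrite !inE.
case/andP=> /andP[iA _] /andP[jA /exists_inP[m mA jm]].
have := stableP st iA jA; rewrite !negb_or /= => /andP[-> _] /=.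
apply/negP=> /andP[i0 /eqP jn].
have := stableP st jA mA; have := stableP st iA mA; rewrite /= i0 !negb_or /= => /andP[_ mn] /andP[mj _].
have jS : j.+1 = n by rewrite jn prednK // (leq_ltn_trans _ (ltn_ord j)).
have le_mn : m < n.+1 by have := ltn_ord m; rewrite ltnS leq_eqVlt (negbTE mn).
have : m <= j.+1 by rewrite jS.
by rewrite leq_eqVlt (negbTE mj) ltnS leqNgt jm.
Qed.

Lemma drop_max_disjoint A B : [disjoint A & B] -> [disjoint drop_max A & drop_max B].
Proof.
move=> dAB; rewrite disjoints_subset; apply/subsetP=> i; rewrite !inE.
by case/andP=> /(disjointFr dAB) ->.
Qed.

End Shrink.

Lemma SG_hom_step n k : has_hom_S4 n k -> has_hom_S4 n.+2 k.+1.
Proof.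
case=> f hf; have sub (v : SGvert n.+2 k.+1) : (#|drop_max (val v)| == k) && stableb (drop_max (val v)).
  by have /andP[cv sv] := valP v; rewrite card_drop_max ?stable_drop_max.
exists (fun v => f (Sub (drop_max (val v)) (sub v))) => u v duv; apply: hf.
by rewrite /SGadj !SubK drop_max_disjoint.
Qed.

Theorem mainTheorem3 :
  (forall k : nat, 2 <= k ->
     exists f : SGvert (2 * k + 2) k -> Svert 4,
       is_hom (@SGadj (2 * k + 2) k) (@Sadj 4) f) /\
  (forall k : nat, 1 <= k ->
     ~ exists f : KGvert (2 * k + 2) k -> Svert 4,
       is_hom (@KGadj (2 * k + 2) k) (@Sadj 4) f).
Proof.
split=> [k|[//|l] _ [f]]; last exact: KG_no_hom.
case: k => [|[|k]] // _; rewrite -/(has_hom_S4 _ _); elim: k => [|k IHk]; first exact: SG62_hom.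
by rewrite mulnS 2!addSn; apply: SG_hom_step.
Qed.
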